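(* Let $\mathbb{K}=\mathbb{R}$ or $\mathbb{K}=\mathbb{C}$, let $m\geq 2$ be an integer, and let $p_1,p_2$ be real numbers with $m<p_{1}\leq p_{2}\leq 2m$. Then $$D_{m,p_{1}}^{\mathbb{K}}\leq D_{m,p_{2}}^{\mathbb{K}}.$$
   Context: For a positive integer $n$ and $1\le p<\infty$, $\ell_p^n$ denotes $\mathbb{K}^n$ with the norm $\|x\|_p=\left(\sum_{i=1}^n|x_i|^p\right)^{1/p}$, and $e_1,\dots,e_n$ are its canonical unit vectors. For an $m$-linear form $T:\ell_p^n\times\cdots\times\ell_p^n\to\mathbb{K}$, its norm is $\|T\|=\sup\{|T(x^{(1)},\dots,x^{(m)})| : \|x^{(k)}\|_p\le 1,\ k=1,\dots,m\}$. For an integer $m\ge 2$ and real $p$ with $m<p\le 2m$, $D_{m,p}^{\mathbb{K}}$ denotes the optimal (i.e. smallest) constant $D\geq 1$ such that $$\left(\sum_{j_1,\dots,j_m=1}^{n}|T(e_{j_1},\dots,e_{j_m})|^{\frac{p}{p-m}}\right)^{\frac{p-m}{p}}\leq D\,\|T\|$$ for all positive integers $n$ and all $m$-linear forms $T:\ell_p^n\times\cdots\times\ell_p^n\to\mathbb{K}$. (By the Hardy--Littlewood inequality for $m$-linear forms, such a finite constant exists.) *)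

(* Defs.v *)
From HB Require Import structures.
From mathcomp Require Import all_boot all_order all_algebra.
From mathcomp Require Import complex.
From mathcomp Require Import all_classical all_reals all_analysis.
Import Order.TTheory GRing.Theory Num.Theory.

Set Implicit Arguments.
Unset Strict Implicit.
Unset Printing Implicit Defensive.

Local Open Scope classical_set_scope.
Local Open Scope ring_scope.

Section HardyLittlewood.
(* The scalar field K is R or R[i]. Since MathComp's norm on R[i] is
   R[i]-valued, the R-valued absolute value is a parameter: `|_| on R and
   normc on R[i]. *)
Variables (R : realType) (K : fieldType) (abs : K -> R).

Definition lp_norm (p : R) (n : nat) (x : 'rV[K]_n) : R :=
  (\sum_(i < n) abs (x 0 i) `^ p) `^ p^-1.

Definition multilinear_form (m n : nat) (T : ('I_m -> 'rV[K]_n) -> K) : Prop :=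
  forall (k : 'I_m) (x : 'I_m -> 'rV[K]_n),
    scalar (fun v : 'rV[K]_n => T (@dfwith 'I_m (fun=> 'rV[K]_n) x k v)).

Definition form_norm (p : R) (m n : nat) (T : ('I_m -> 'rV[K]_n) -> K) : \bar R :=
  ereal_sup [set (abs (T x))%:E | x in
    [set x : 'I_m -> 'rV[K]_n | forall k, lp_norm p (x k) <= 1]].

Definition coeff_norm (p : R) (m n : nat) (T : ('I_m -> 'rV[K]_n) -> K) : R :=
  (\sum_(j : {ffun 'I_m -> 'I_n})
     abs (T (fun k => delta_mx 0 (j k))) `^ (p / (p - m%:R))) `^ ((p - m%:R) / p).

Definition HL_bound (m : nat) (p : R) (D : R) : Prop :=
  1 <= D /\
  forall (n : nat) (T : ('I_m -> 'rV[K]_n) -> K),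
    (0 < n)%N -> multilinear_form T ->
    ((coeff_norm p T)%:E <= D%:E * form_norm p T)%E.

(* The infimum is taken in \bar R, so that the value would be +oo if no finite
   constant existed; otherwise it is attained, see HL_constantP. *)
Definition HL_constant (m : nat) (p : R) : \bar R :=
  ereal_inf [set D%:E | D in HL_bound m p].

Lemma HL_constantP (m : nat) (p D0 : R) : HL_bound m p D0 ->
  exists D : R, [/\ HL_constant m p = D%:E, HL_bound m p D &
    forall D' : R, HL_bound m p D' -> D <= D'].
Proof.
move=> hD0.
have lb D' : HL_bound m p D' -> (HL_constant m p <= D'%:E)%E.
  by move=> h; apply: ereal_inf_lbound; exists D'.
have ge1 : (1%:E <= HL_constant m p)%E.
  by apply: le_ereal_inf_tmp => _ [D' [D'1 _] <-]; rewrite lee_fin.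
have {}lb0 := lb _ hD0.
case E : (HL_constant m p) => [D| |]; last 2 first.
- by move: lb0; rewrite E.
- by move: ge1; rewrite E.
exists D; split=> //; last by move=> D' /lb; rewrite E lee_fin.
split; first by move: ge1; rewrite E lee_fin.
move=> n T n0 mT.
have [D01 /(_ n T n0 mT)] := hD0.
have D0gt0 : 0 < D0 by apply: lt_le_trans D01.
have Dgt0 : 0 < D by move: ge1; rewrite E lee_fin; apply: lt_le_trans.
have S0 : 0 <= coeff_norm p T by apply: powR_ge0.
case F : (form_norm p T) => [r| |]; last 2 first.
- by rewrite !gt0_muley ?lte_fin// leey.
- by rewrite gt0_muleNy ?lte_fin.
rewrite -!EFinM !lee_fin => le0.
have : 0 <= r by move: (le_trans S0 le0); rewrite pmulr_rge0.
rewrite le_eqVlt => /predU1P[r0|r0]; first by move: le0; rewrite -r0 !mulr0.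
rewrite -ler_pdivrMr// -lee_fin -E.
apply: le_ereal_inf_tmp => _ [D' [_ /(_ n T n0 mT) hD'] <-].
by move: hD'; rewrite F -EFinM !lee_fin ler_pdivrMr.
Qed.

End HardyLittlewood.

Definition HL_constant_real (R : realType) (m : nat) (p : R) : \bar R :=
  HL_constant (fun x : R => `|x|) m p.

Definition HL_constant_complex (R : realType) (m : nat) (p : R) : \bar R :=
  HL_constant (@ComplexField.Normc.normc R) m p.

(* Main.v *)
(* Put s_i = p_i / (p_i - m) and d = 1/p1 - 1/p2, so that 1/s2 - 1/s1 = d m.
   Composing T with diagonal operators whose entries are the d-th powers of
   probability weights gives a form T' with ||T'||_{p2} <= ||T||_{p1}, by
   Hoelder.  Take for the k-th weight the k-th marginal of the probability
   b_j proportional to |T(e_j)|^{s1}.  Each marginal dominates b_j, hence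
   |T'(e_j)| >= |T(e_j)| b_j^{d m}, and the right-hand side has s2-norm equal to
   the s1-norm of the coefficients of T.  So a constant admissible for p2 is
   admissible for p1. *)
Require Import Defs.
From HB Require Import structures.
From mathcomp Require Import all_boot all_order all_algebra.
From mathcomp Require Import complex.
From mathcomp Require Import all_classical all_reals all_analysis.
From mathcomp Require Import ring.
Import Order.TTheory GRing.Theory Num.Theory.
Local Open Scope ring_scope.

Set Implicit Arguments.
Unset Strict Implicit.
Unset Printing Implicit Defensive.

(** Slots are scaled one at a time, by induction on a list of slots; [uniq] ensures that no slot is
    scaled twice, and the full enumeration of ['I_m] gives the claim. *)
Lemma multilinear_formZ (K : fieldType) (m n : nat)
    (T : ('I_m -> 'rV[K]_n) -> K) (c : 'I_m -> K) (x : 'I_m -> 'rV[K]_n) :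
  multilinear_form T -> T (fun k => c k *: x k) = (\prod_k c k) * T x.
Proof.
move=> mT.
have T_dfwithZ z k a v : T (@dfwith 'I_m (fun=> 'rV[K]_n) z k (a *: v)) =
    a * T (@dfwith 'I_m (fun=> 'rV[K]_n) z k v).
  have T0 : T (@dfwith 'I_m (fun=> 'rV[K]_n) z k 0) = 0.
    have /= := mT k z 1 0 0; rewrite scale1r addr0 mul1r => /eqP.
    by rewrite -subr_eq0 opprD addrA subrr sub0r oppr_eq0 => /eqP.
  by have /= := mT k z a v 0; rewrite T0 !addr0.
have T_seqZ (s : seq 'I_m) : uniq s ->
    T (fun k => if k \in s then c k *: x k else x k) =
    (\prod_(k <- s) c k) * T x.
  elim: s => [_|k s IHs /= /andP[ks us]].
    by rewrite big_nil mul1r.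
  rewrite big_cons -mulrA -IHs//.
  have -> : (fun l => if l \in k :: s then c l *: x l else x l) =
      @dfwith 'I_m (fun=> 'rV[K]_n)
        (fun l => if l \in s then c l *: x l else x l) k (c k *: x k).
    apply/funext => l; rewrite inE.
    by case: dfwithP => [|j]; rewrite ?eqxx// eq_sym => /negbTE ->.
  rewrite T_dfwithZ; congr (_ * T _); apply/funext => l.
  by case: dfwithP => [|j //]; rewrite (negbTE ks).
rewrite -[LHS]/(T (fun k => if true then c k *: x k else x k)).
have := T_seqZ (enum 'I_m) (enum_uniq _).
rewrite big_enum => <-; congr T; apply/funext => k.
by rewrite mem_enum.
Qed.

Definition diag_form (K : fieldType) (m n : nat) (w : 'I_m -> 'I_n -> K)
    (T : ('I_m -> 'rV[K]_n) -> K) (x : 'I_m -> 'rV[K]_n) : K :=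
  T (fun k => \row_i (w k i * x k 0 i)).

Lemma diag_form_multilinear (K : fieldType) (m n : nat)
    (w : 'I_m -> 'I_n -> K) (T : ('I_m -> 'rV[K]_n) -> K) :
  multilinear_form T -> multilinear_form (diag_form w T).
Proof.
move=> mT k x.
pose D l (v : 'rV[K]_n) : 'rV[K]_n := \row_i (w l i * v 0 i).
have diagE v : diag_form w T (@dfwith 'I_m (fun=> 'rV[K]_n) x k v) =
    T (@dfwith 'I_m (fun=> 'rV[K]_n) (fun l => D l (x l)) k (D k v)).
  congr T; apply/funext => l; rewrite -/(D l _).
  by case: dfwithP => [|j kj]; rewrite ?dfwithin// dfwithout.
move=> a u v /=; rewrite !diagE -mT; congr (T (dfwith _ _ _)).
by apply/rowP => i; rewrite !mxE mulrDr mulrCA.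
Qed.

Lemma diag_form_delta (K : fieldType) (m n : nat) (w : 'I_m -> 'I_n -> K)
    (T : ('I_m -> 'rV[K]_n) -> K) (j : 'I_m -> 'I_n) :
  multilinear_form T ->
  diag_form w T (fun k => delta_mx 0 (j k)) =
  (\prod_k w k (j k)) * T (fun k => delta_mx 0 (j k)).
Proof.
move=> mT; rewrite -multilinear_formZ//; congr T; apply/funext => k.
apply/rowP => i; rewrite !mxE eqxx /=.
by have [->|] := eqVneq i (j k); rewrite ?mulr0.
Qed.

(** Hoelder's inequality for 1/p1 = (1/p1 - 1/p2) + 1/p2. Since both factors are already normalised,
    it suffices to sum Young's inequality over the coordinates. *)
Lemma lp_norm_diag_le1 (R : realType) (K : fieldType) (abs : K -> R)
    (p1 p2 : R) (n : nat) (u : 'I_n -> R) (w : 'I_n -> K) (x : 'rV[K]_n) :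
  {morph abs : a b / a * b} -> (forall a, 0 <= abs a) ->
  0 < p1 -> p1 < p2 -> (forall i, 0 <= u i) -> \sum_i u i <= 1 ->
  (forall i, abs (w i) = u i `^ (p1^-1 - p2^-1)) ->
  lp_norm abs p2 x <= 1 ->
  lp_norm abs p1 (\row_i (w i * x 0 i)) <= 1.
Proof.
move=> absM abs0 p10 p12 u0 u1 wE x1.
have p20 : 0 < p2 by exact: lt_trans p12.
have p1N0 := lt0r_neq0 p10; have p2N0 := lt0r_neq0 p20.
have d0 : 0 < p1^-1 - p2^-1 by rewrite subr_gt0 ltf_pV2.
have {}x1 : \sum_i abs (x 0 i) `^ p2 <= 1.
  have s0 : 0 <= \sum_i abs (x 0 i) `^ p2.
    by apply: sumr_ge0 => i _; exact: powR_ge0.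
  have := ge0_ler_powR (ltW p20) (powR_ge0 _ _) ler01 x1.
  by rewrite powR1 -powRrM mulVf// powRr1.
rewrite /lp_norm; apply: (@le_trans _ _ (1 `^ p1^-1)); last by rewrite powR1.
rewrite ge0_ler_powR ?nnegrE ?invr_ge0 ?(ltW p10)//.
  by apply: sumr_ge0 => i _; exact: powR_ge0.
pose q := ((p1^-1 - p2^-1) * p1)^-1.
have pq1 : q^-1 + (p2 / p1)^-1 = 1.
  by rewrite /q invrK invf_div mulrBl mulVf// [p2^-1 * _]mulrC subrK.
apply: (@le_trans _ _ (\sum_i (u i / q + abs (x 0 i) `^ p2 / (p2 / p1)))).
  apply: ler_sum => i _.
  rewrite mxE absM powRM// wE -powRrM.
  have := @conjugate_powR R (u i `^ ((p1^-1 - p2^-1) * p1))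
    (abs (x 0 i) `^ p1) q (p2 / p1).
  rewrite -!powRrM /q divff ?powRr1 ?mulf_neq0 ?lt0r_neq0//.
  rewrite [p1 * (p2 / p1)]mulrCA divff// mulr1; apply.
  - exact: powR_ge0.
  - exact: powR_ge0.
  - by rewrite invr_gt0 mulr_gt0.
  - exact: divr_gt0.
  - exact: pq1.
rewrite big_split /= -!mulr_suml.
have q0 : 0 < q by rewrite invr_gt0 mulr_gt0.
by rewrite -pq1 lerD// ler_piMl// invr_ge0 ltW// divr_gt0.
Qed.

(** The diagonal operators send the unit ball for [p2] into the one for [p1], so the left supremum
    runs over a subset of the values on the right. *)
Lemma form_norm_diag_le (R : realType) (K : fieldType) (abs : K -> R)
    (p1 p2 : R) (m n : nat) (u : 'I_m -> 'I_n -> R) (w : 'I_m -> 'I_n -> K)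
    (T : ('I_m -> 'rV[K]_n) -> K) :
  {morph abs : a b / a * b} -> (forall a, 0 <= abs a) ->
  0 < p1 -> p1 < p2 -> (forall k i, 0 <= u k i) ->
  (forall k, \sum_i u k i <= 1) ->
  (forall k i, abs (w k i) = u k i `^ (p1^-1 - p2^-1)) ->
  (form_norm abs p2 (diag_form w T) <= form_norm abs p1 T)%E.
Proof.
move=> absM abs0 p10 p12 u0 u1 wE.
apply: ereal_sup_le => _ [x /= x1 <-].
exists (fun k => \row_i (w k i * x k 0 i)); last by [].
by move=> k; apply: (lp_norm_diag_le1 absM abs0 p10 p12 (u0 k) (u1 k) (wE k)).
Qed.

(** Stated for an abstract [abs] so that one argument serves both fields; [iota] turns nonnegative
    real weights into scalars of the same absolute value. *)
Lemma HL_bound_decreasing (R : realType) (K : fieldType) (abs : K -> R)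
    (iota : R -> K) (m : nat) (p1 p2 D : R) :
  {morph abs : a b / a * b} -> (forall a, 0 <= abs a) ->
  (forall r, 0 <= r -> abs (iota r) = r) ->
  m%:R < p1 -> p1 <= p2 -> HL_bound abs m p2 D -> HL_bound abs m p1 D.
Proof.
move=> absM abs0 iotaE mp1; rewrite le_eqVlt => /predU1P[->//|p12].
move=> [D1 hD]; split=> [|n T n0 mT]; first exact: D1.
have p10 : 0 < p1 by exact: le_lt_trans mp1.
have p20 : 0 < p2 by exact: lt_trans p12.
have D0 : 0 < D by exact: lt_le_trans D1.
have p1m : 0 < p1 - m%:R by rewrite subr_gt0.
have p2m : 0 < p2 - m%:R by rewrite subr_gt0 (lt_trans mp1).
have p1N0 := lt0r_neq0 p10; have p2N0 := lt0r_neq0 p20.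
have p1mN0 := lt0r_neq0 p1m; have p2mN0 := lt0r_neq0 p2m.
set s1 := p1 / (p1 - m%:R); set s2 := p2 / (p2 - m%:R).
have s10 : 0 < s1 by rewrite divr_gt0.
have s20 : 0 < s2 by rewrite divr_gt0.
pose d := p1^-1 - p2^-1.
have d0 : 0 < d by rewrite subr_gt0 ltf_pV2.
pose a (j : {ffun 'I_m -> 'I_n}) := abs (T (fun k => delta_mx 0 (j k))).
have a0 j : 0 <= a j by exact: abs0.
pose N := \sum_j a j `^ s1.
(* The weights [b] require division by [N], so [N = 0] is treated apart: the coefficient norm is
   then 0, and the zero tuple shows that the form norm is nonnegative. *)
have /predU1P[N0|N0] : (0 == N) || (0 < N).
  by rewrite -le_eqVlt; apply: sumr_ge0 => j _; exact: powR_ge0.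
  rewrite /coeff_norm -/s1 -/N -N0 powR0; last by rewrite mulf_neq0 ?invr_neq0.
  apply: mule_ge0; first by rewrite lee_fin ltW.
  apply: le_ereal_sup_tmp; exists (abs (T (fun=> 0)))%:E; last by rewrite lee_fin.
  exists (fun=> 0) => // k; rewrite /lp_norm big1 ?powR0 ?invr_neq0// => i _.
  (* Multiplicativity at [iota 0 * 0] forces this, as [abs (iota 0) = 0]. *)
  rewrite mxE; have abs00 : abs 0 = 0.
    have := absM (iota 0) 0; rewrite mulr0 iotaE// mul0r//.
  by rewrite abs00 powR0.
pose b j := a j `^ s1 / N.
have b0 j : 0 <= b j by rewrite divr_ge0 ?powR_ge0 ?ltW.
pose u k i := \sum_(j : {ffun 'I_m -> 'I_n} | j k == i) b j.
have u0 k i : 0 <= u k i by exact: sumr_ge0.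
have u1 k : \sum_i u k i <= 1.
  have <- : \sum_j b j = 1 by rewrite -mulr_suml divff// lt0r_neq0.
  by rewrite [leRHS](partition_big (fun j : {ffun _} => j k) xpredT).
have bu k (j : {ffun 'I_m -> 'I_n}) : b j <= u k (j k).
  by rewrite /u (bigD1 j)//= lerDl sumr_ge0.
pose w k i := iota (u k i `^ d).
have wE k i : abs (w k i) = u k i `^ d by rewrite iotaE ?powR_ge0.
have le_form : (D%:E * form_norm abs p2 (diag_form w T) <=
                D%:E * form_norm abs p1 T)%E.
  apply: lee_wpmul2l; first by rewrite lee_fin ltW.
  exact: form_norm_diag_le u0 u1 wE.
apply: le_trans le_form.
apply: le_trans (hD n _ n0 (diag_form_multilinear _ mT)).
rewrite lee_fin /coeff_norm -/s1 -/s2 -/N.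
have abs_prod (F : 'I_m -> K) : abs (\prod_k F k) = \prod_k abs (F k).
  apply: (big_morph abs absM).
  have := absM (iota 1) 1; rewrite mulr1 iotaE// mul1r//.
have coeff_ge j : a j * b j `^ (d * m%:R) <=
    abs (diag_form w T (fun k => delta_mx 0 (j k))).
  rewrite diag_form_delta// absM mulrC ler_wpM2r// abs_prod.
  rewrite powRrM powR_mulrn ?powR_ge0// -[X in _ ^+ X]card_ord -prodr_const.
  apply: ler_prod => k _; rewrite powR_ge0 wE /=.
  by rewrite ge0_ler_powR ?nnegrE// ltW.
(* The exponent of [a j] is s2 + s1 d m s2, which equals s1 because 1/s2 - 1/s1 = d m. *)
have coeffE j : (a j * b j `^ (d * m%:R)) `^ s2 =
    a j `^ s1 * N `^ (- (d * m%:R * s2)).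
  have dm0 : 0 <= d * m%:R by rewrite mulr_ge0 ?ler0n ?(ltW d0).
  rewrite powRM ?powR_ge0//.
  rewrite /b powRM ?powR_ge0 ?invr_ge0 ?(ltW N0)//.
  rewrite -[N^-1]powR_inv1 ?(ltW N0)// -!powRrM.
  rewrite powRM ?powR_ge0// -!powRrM mulrA -powRD; last first.
    (* [a j] may vanish, so adding exponents is justified by their sum being positive. *)
    apply/implyP; rewrite gt_eqF// ltr_pwDl//.
    by rewrite mulr_ge0 ?(ltW s20)// mulr_ge0 ?(ltW s10).
  rewrite mulN1r mulNr; congr (_ `^ _ * _).
  by rewrite /s1 /s2 /d; field; rewrite ?p1N0 ?p2N0 ?p1mN0 ?p2mN0.
(* The sum is N^(1 - d m s2) = N^(s2/s1), and its power 1/s2 is N^(1/s1). *)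
have -> : N `^ ((p1 - m%:R) / p1) =
    (\sum_j (a j * b j `^ (d * m%:R)) `^ s2) `^ ((p2 - m%:R) / p2).
  rewrite (eq_bigr _ (fun j _ => coeffE j)) -mulr_suml -/N.
  rewrite -{2}[N]powRr1 ?(ltW N0)// -powRD; last by rewrite lt0r_neq0 ?implybT.
  rewrite -powRrM; congr (_ `^ _).
  by rewrite /s2 /d; field; rewrite ?p1N0 ?p2N0 ?p1mN0 ?p2mN0.
rewrite ge0_ler_powR ?nnegrE ?divr_ge0 ?(ltW p2m) ?(ltW p20)//.
- by apply: sumr_ge0 => j _; exact: powR_ge0.
- by apply: sumr_ge0 => j _; exact: powR_ge0.
apply: ler_sum => j _.
by rewrite ge0_ler_powR ?nnegrE ?(ltW s20) ?coeff_ge// mulr_ge0 ?powR_ge0.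
Qed.

Theorem theorem1 (R : realType) (m : nat) (p1 p2 : R) :
  (2 <= m)%N -> m%:R < p1 -> p1 <= p2 -> p2 <= (2 * m)%:R ->
  (HL_constant_real m p1 <= HL_constant_real m p2)%E /\
  (HL_constant_complex m p1 <= HL_constant_complex m p2)%E.
Proof.
move=> _ mp1 p12 _.
(* The constants admissible for [p2] form a subset of those for [p1], which reverses the order of
   the infima. *)
split; apply: ereal_inf_le_tmp => _ [D hD <-];
  (exists D; last by []).
- apply: (HL_bound_decreasing (iota := id) _ _ _ mp1 p12 hD).
  + exact: normrM.
  + by move=> a; exact: normr_ge0.
  + by move=> r; exact: ger0_norm.
- apply: (HL_bound_decreasing (iota := fun r => r%:C%C) _ _ _ mp1 p12 hD).
  + exact: ComplexField.Normc.normcM.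
  + by move=> [x y]; exact: sqrtr_ge0.
  + by move=> r r0 /=; rewrite expr0n addr0 sqrtr_sqr ger0_norm.
Qed.
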